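(* Let $\boldsymbol{X}=(\boldsymbol{Q}_1^T,\boldsymbol{Q}_2^T,\boldsymbol{Q}_3^T,\boldsymbol{P}_1^T,\boldsymbol{P}_2^T,\boldsymbol{P}_3^T)^T\in\mathbb{R}^{24}$. The quadratic forms $\boldsymbol{X}^TM\boldsymbol{X}$ ($M$ a real symmetric $24\times24$ matrix) that are invariant under the diagonal action $\Psi_S$ for all $S\in G$ are exactly those with matrix $$M=[W]_{\mathrm{sym}}\otimes I_4+[W]_{\mathrm{skew}}\otimes K,$$ where $W$ is an arbitrary real $6\times6$ matrix and $\otimes$ denotes the Kronecker product. The vector space of quadratic invariants of this form is closed under the Poisson bracket.
   Context: The phase space is $T^*\mathbb{R}^{12}\cong\mathbb{R}^{24}$ with coordinates $\boldsymbol{Q}_i,\boldsymbol{P}_i\in\mathbb{R}^4$ (column vectors), $i=1,2,3$, and the standard Poisson bracket: the components satisfy $\{Q_{i,a},P_{j,b}\}=\delta_{ij}\delta_{ab}$, all other brackets of coordinates being zero. $[W]_{\mathrm{sym}}=\tfrac12(W+W^T)$ and $[W]_{\mathrm{skew}}=\tfrac12(W-W^T)$. Let $$K=\begin{pmatrix}0&0&0&-1\\0&0&1&0\\0&-1&0&0\\1&0&0&0\end{pmatrix},\qquad \operatorname{Isoc}(\hat{\boldsymbol L})=\begin{pmatrix}\hat{\boldsymbol L}&-\boldsymbol L\\ \boldsymbol L^{t}&0\end{pmatrix}\quad(\boldsymbol L\in\mathbb{R}^3),$$ where $\hat{\boldsymbol L}$ is the skew $3\times3$ matrix with $\hat{\boldsymbol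 L}\boldsymbol v=\boldsymbol L\times\boldsymbol v$. Let $G\subset SO(4)$ be the subgroup of all matrices $\exp\!\big(\tfrac12(\operatorname{Isoc}(\hat{\boldsymbol L})+\tau K)\big)$, $\boldsymbol L\in\mathbb{R}^3$, $\tau\in\mathbb{R}$. For $S\in G$ the diagonal action is $\Psi_S:(\boldsymbol{Q}_i,\boldsymbol{P}_i)_{i=1}^3\mapsto(S\boldsymbol{Q}_i,S\boldsymbol{P}_i)_{i=1}^3$. *)

(* Defs.v *)
From HB Require Import structures.
From mathcomp Require Import all_boot all_order all_algebra.
From mathcomp Require Import all_classical all_reals all_analysis.
From mathcomp Require Export mxtens.
Set Implicit Arguments.
Unset Strict Implicit.
Unset Printing Implicit Defensive.
Import Order.TTheory GRing.Theory Num.Theory numFieldNormedType.Exports.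
Local Open Scope classical_set_scope.
Local Open Scope ring_scope.

Definition sympart (R : realType) n (W : 'M[R]_n) : 'M[R]_n := 2^-1 *: (W + W^T).

Definition skewpart (R : realType) n (W : 'M[R]_n) : 'M[R]_n := 2^-1 *: (W - W^T).

Definition mx_of_rows (R : realType) n (s : seq (seq R)) : 'M[R]_n :=
  \matrix_(i, j) nth 0 (nth [::] s i) j.

Definition Kmx (R : realType) : 'M[R]_4 := mx_of_rows 4
  [:: [:: 0;  0; 0; -1];
      [:: 0;  0; 1;  0];
      [:: 0; -1; 0;  0];
      [:: 1;  0; 0;  0]].

Definition o0 : 'I_3 := @Ordinal 3 0 isT.
Definition o1 : 'I_3 := @Ordinal 3 1 isT.
Definition o2 : 'I_3 := @Ordinal 3 2 isT.

Definition crossv (R : realType) (u v : 'cV[R]_3) : 'cV[R]_3 :=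
  \col_i nth 0 [:: u o1 0 * v o2 0 - u o2 0 * v o1 0;
                   u o2 0 * v o0 0 - u o0 0 * v o2 0;
                   u o0 0 * v o1 0 - u o1 0 * v o0 0] i.

Definition hatmx (R : realType) (L : 'cV[R]_3) : 'M[R]_3 := mx_of_rows 3
  [:: [::        0; - L o2 0;   L o1 0];
      [::   L o2 0;        0; - L o0 0];
      [:: - L o1 0;   L o0 0;        0]].

Lemma mul_hatmx (R : realType) (L v : 'cV[R]_3) : hatmx L *m v = crossv L v.
Proof.
apply/matrixP => i j; rewrite ord1 {j} !mxE.
rewrite big_ord_recl big_ord_recl big_ord_recl big_ord0 !mxE.
have -> : lift ord0 ord0 = o1 by apply: val_inj.
have -> : lift ord0 (lift ord0 ord0) = o2 by apply: val_inj.
have -> : ord0 = o0 by apply: val_inj.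
by case: i => -[|[|[|//]]] ? /=;
  rewrite !mul0r ?addr0 ?add0r !mulNr // addrC.
Qed.

Definition isoc (R : realType) (L : 'cV[R]_3) : 'M[R]_4 :=
  block_mx (hatmx L) (- L) L^T (0 : 'M[R]_1).

Definition expmx (R : realType) n (A : 'M[R]_n.+1) : 'M[R]_n.+1 :=
  limn (series (fun k => (k`!%:R)^-1 *: A ^+ k)).

Definition G (R : realType) : set 'M[R]_4 :=
  [set S | exists (L : 'cV[R]_3) (tau : R),
     S = expmx (2^-1 *: (isoc L + tau *: Kmx R))].

(* Phase space: R^24 as six stacked blocks Q_1, Q_2, Q_3, P_1, P_2, P_3 of size
   four, indexed by the same [mxtens_index] as the Kronecker product [*t]. *)
Notation phase R := 'cV[R]_(6 * 4).

Definition Qidx (i : 'I_3) (a : 'I_4) : 'I_(6 * 4) :=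
  mxtens_index (lshift 3 i : 'I_6, a).

Definition Pidx (i : 'I_3) (a : 'I_4) : 'I_(6 * 4) :=
  mxtens_index (rshift 3 i : 'I_6, a).

Definition Qpart (R : realType) (X : phase R) (i : 'I_3) : 'cV[R]_4 :=
  \col_a X (Qidx i a) 0.

Definition Ppart (R : realType) (X : phase R) (i : 'I_3) : 'cV[R]_4 :=
  \col_a X (Pidx i a) 0.

Definition stack (R : realType) (Q P : 'I_3 -> 'cV[R]_4) : phase R :=
  \col_(k < 6 * 4) match @fintype.split 3 3 (mxtens_unindex k).1 with
         | inl i => Q i (mxtens_unindex k).2 0
         | inr i => P i (mxtens_unindex k).2 0
         end.

Lemma stackK (R : realType) (Q P : 'I_3 -> 'cV[R]_4) i :
  Qpart (stack Q P) i = Q i /\ Ppart (stack Q P) i = P i.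
Proof.
split; apply/matrixP => a j; rewrite ord1 !mxE mxtens_indexK /=.
  by rewrite (_ : fintype.split _ = inl i) //; exact: (unsplitK (inl i : 'I_3 + 'I_3)).
by rewrite (_ : fintype.split _ = inr i) //; exact: (unsplitK (inr i : 'I_3 + 'I_3)).
Qed.

Definition Psi (R : realType) (S : 'M[R]_4) (X : phase R) : phase R :=
  stack (fun i => S *m Qpart X i) (fun i => S *m Ppart X i).

Definition qform (R : realType) (M : 'M[R]_(6 * 4)) (X : phase R) : R :=
  (X^T *m M *m X) 0 0.

Definition partial (R : realType) (f : phase R -> R) (k : 'I_(6 * 4))
    (X : phase R) : R :=
  'D_(delta_mx k 0) f X.

Definition poisson (R : realType) (f g : phase R -> R) : phase R -> R :=
  fun X => \sum_(i < 3) \sum_(a < 4)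
    (partial f (Qidx i a) X * partial g (Pidx i a) X
     - partial f (Pidx i a) X * partial g (Qidx i a) X).

Lemma partial_coord (R : realType) (k l : 'I_(6 * 4)) (X : phase R) :
  partial (fun Y : phase R => Y l 0) k X = (k == l)%:R.
Proof.
rewrite /partial /derive; apply: cvg_lim => //.
apply: (@cvg_trans _ (cst ((k == l)%:R : R) @ 0^')); last exact: cvg_cst.
apply: near_eq_cvg; near=> h.
have h0 : h != 0 by near: h; exact: nbhs_dnbhs_neq.
by rewrite /= !mxE eqxx andbT addrK [l == k]eq_sym /GRing.scale /= mulKf.
Unshelve. all: by end_near.
Qed.

Lemma poisson_coord (R : realType) (i j : 'I_3) (a b : 'I_4) (X : phase R) :
  let q i a := fun Y : phase R => Y (Qidx i a) 0 in
  let p i a := fun Y : phase R => Y (Pidx i a) 0 in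
  [/\ poisson (q i a) (p j b) X = ((i == j) && (a == b))%:R,
      poisson (q i a) (q j b) X = 0 &
      poisson (p i a) (p j b) X = 0].
Proof.
have eqQ i1 a1 i2 a2 : (Qidx i1 a1 == Qidx i2 a2) = (i1 == i2) && (a1 == a2).
  rewrite (can_eq (@mxtens_indexK 6 4)) xpair_eqE.
  by rewrite (inj_eq (@lshift_inj 3 3)).
have eqP' i1 a1 i2 a2 : (Pidx i1 a1 == Pidx i2 a2) = (i1 == i2) && (a1 == a2).
  rewrite (can_eq (@mxtens_indexK 6 4)) xpair_eqE.
  by rewrite (inj_eq (@rshift_inj 3 3)).
have eqQP i1 a1 i2 a2 : (Qidx i1 a1 == Pidx i2 a2) = false.
  rewrite (can_eq (@mxtens_indexK 6 4)) xpair_eqE.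
  by rewrite (@eq_lrshift 3 3).
have eqPQ i1 a1 i2 a2 : (Pidx i1 a1 == Qidx i2 a2) = false.
  by rewrite eq_sym eqQP.
move=> q p; rewrite /poisson; split; last 2 first.
- apply: big1 => k _; apply: big1 => c _.
  by rewrite !partial_coord eqPQ eqPQ mulr0 mul0r subr0.
- apply: big1 => k _; apply: big1 => c _.
  by rewrite !partial_coord !eqQP mulr0 mul0r subr0.
rewrite (bigD1 i) //= (bigD1 a) //= [X in _ + X]big1 => [|k ki]; last first.
  apply: big1 => c _.
  by rewrite !partial_coord eqQ eqPQ (negbTE ki) !mul0r subr0.
rewrite [X in _ + X + 0]big1 => [|c ca]; last first.
  by rewrite !partial_coord eqQ eqPQ (negbTE ca) andbF !mul0r subr0.
by rewrite !partial_coord eqQ eqP' eqPQ !eqxx mul1r mul0r subr0 !addr0.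
Qed.

Definition inv_mx (R : realType) (W : 'M[R]_6) : 'M[R]_(6 * 4) :=
  sympart W *t (1%:M : 'M[R]_4) + skewpart W *t Kmx R.

Definition quad_inv (R : realType) : set (phase R -> R) :=
  [set f | exists W : 'M[R]_6, f = qform (inv_mx W)].

(* Main.v *)
(* For [isoc u] of square [-1], [J = isoc u] and [K] commute and both square to
   [-1], so [exp (a J + b K) = (cos a + sin a J) (cos b + sin b K)]. Hence every
   element of [G] is orthogonal and commutes with [K], and [G] contains [K] and
   the three matrices [isoc e_k]. A symmetric [M] is therefore invariant iff it
   commutes with [1 *t S] for all [S] in [G], and then each of its 4 x 4 blocks
   commutes with [isoc e_k] and [K], hence lies in the span of [1] and [K].
   Conversely such [M] commute with [1 *t S]. Finally, for the symplectic matrix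
   [w], the bracket of the forms of [M] and [N] is the form of
   [4 M (w *t 1) N], and the matrices [a *t 1 + b *t K] form an algebra whose
   symmetric parts are exactly the matrices of the statement. *)
Require Import Defs.
From mathcomp Require Import all_boot all_order all_algebra.
From mathcomp Require Import all_classical all_reals all_analysis.
From mathcomp Require Import ring lra.
Import Order.TTheory GRing.Theory Num.Theory numFieldNormedType.Exports.
Local Open Scope classical_set_scope.
Local Open Scope ring_scope.

(** * Exponential series of two commuting square roots of [-1] *)

Lemma cvg_series_scale (R : realType) (V : normedModType R) (u : R^nat) (l : R)
    (v : V) :
  series u @ \oo --> l -> series (fun k => u k *: v) @ \oo --> l *: v.
Proof.
move=> ul; have -> : series (fun k => u k *: v) = fun n => series u n *: v.
  by apply/funext => n; rewrite /series /= scaler_suml.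
exact: cvgZr_tmp.
Qed.

Lemma series_addf (R : realType) (V : normedModType R) (u v : V^nat) :
  series (fun k => u k + v k) = fun n => series u n + series v n.
Proof. by apply/funext => n; rewrite /series /= big_split. Qed.

(** Even powers of [J] are signs and odd ones are signs times [J], while [cos_coeff] and [sin_coeff]
    vanish at odd and even [k] respectively. *)
Lemma sqrN1_expr (R : realType) n (J : 'M[R]_n.+1) (k : nat) (x : R) :
  J * J = -1 ->
  (k`!%:R)^-1 *: (x ^+ k *: J ^+ k) = cos_coeff x k *: 1 + sin_coeff x k *: J.
Proof.
move=> J2; have J2n m : J ^+ m.*2 = (-1) ^+ m *: 1.
  by rewrite -muln2 mulnC exprM expr2 J2 -[in LHS]scaleN1r exprZn expr1n.
rewrite scalerA mulrC /cos_coeff /sin_coeff /= -exprnP.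
have [m ->] : exists m, k = (odd k + m.*2)%N.
  by exists k./2; rewrite odd_double_half.
case: (odd k) => /=.
  rewrite add1n /= uphalf_double doubleK odd_double /= !exprSr J2n.
  by rewrite !mul0r scale0r add0r mul1r mulr_algl scalerA; congr (_ *: _); ring.
rewrite add0n odd_double doubleK J2n !mul0r scale0r addr0 mul1r scalerA.
by congr (_ *: _); ring.
Qed.

Lemma expmx_commuting (R : realType) n (J K : 'M[R]_n.+1) (a b : R) :
  J * J = -1 -> K * K = -1 -> J * K = K * J ->
  expmx (a *: J + b *: K) =
  (cos a *: 1 + sin a *: J) * (cos b *: 1 + sin b *: K).
Proof.
move=> J2 K2 JK; set A := a *: J + b *: K.
(* [P / 2] and [Q / 2] are complementary idempotents, as [J * K] squares to 1;
   on their images [A] acts as [(a - b) J] and [(a + b) J]. *)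
pose P := 1 + J * K; pose Q := 1 - J * K.
have AJ : GRing.comm A J.
  by rewrite /GRing.comm /A mulrDl mulrDr -!scalerAl -!scalerAr JK.
have JJK : J * (J * K) = - K by rewrite mulrA J2 mulN1r.
have KJK : K * (J * K) = - J by rewrite mulrA -JK -mulrA K2 mulrN1.
have AP : A * P = (a - b) *: (J * P).
  rewrite /A /P !mulrDr !mulrDl !mulr1 -!scalerAl JJK KJK.
  by apply/matrixP => i j; rewrite !mxE; ring.
have AQ : A * Q = (a + b) *: (J * Q).
  rewrite /A /Q !mulrBr !mulrDl !mulr1 -!scalerAl JJK KJK.
  by apply/matrixP => i j; rewrite !mxE; ring.
have AE k : A ^+ k = (a - b) ^+ k *: (J ^+ k) * (2^-1 *: P)
                   + (a + b) ^+ k *: (J ^+ k) * (2^-1 *: Q).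
  elim: k => [|k IH].
    rewrite !expr0 !scale1r !mul1r /P /Q.
    (* Generalising keeps [mxE] from unfolding the entries, which become atoms for [field]. *)
    move: (1 : 'M[R]_n.+1) (J * K) => I_ JK_.
    by apply/matrixP => i j; rewrite !mxE; field.
  rewrite exprS IH mulrDr -!scalerAl -!scalerAr !mulrA.
  rewrite !(commrX k AJ) -!mulrA AP AQ -!scalerAr !mulrA -!exprSr !scalerA.
  by congr (_ *: _ + _ *: _); rewrite exprSr; ring.
(* The addition formulas split the product along the two idempotents, matching the limit of the
   series. *)
have -> : (cos a *: 1 + sin a *: J) * (cos b *: 1 + sin b *: K) =
   cos (a - b) *: (2^-1 *: P) + sin (a - b) *: (J * (2^-1 *: P))
 + (cos (a + b) *: (2^-1 *: Q) + sin (a + b) *: (J * (2^-1 *: Q))).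
  have JP : J * P = J - K by rewrite /P mulrDr mulr1 JJK.
  have JQ : J * Q = J + K by rewrite /Q mulrBr mulr1 JJK opprK.
  rewrite -!scalerAr JP JQ /P /Q cosB cosD sinB sinD.
  rewrite mulrDr -!scalerAr mulr1 mulrDl -!scalerAl mul1r.
  move: (1 : 'M[R]_n.+1) (J * K) => I_ JK_.
  by apply/matrixP => i j; rewrite !mxE; field.
apply: cvg_lim; first exact: norm_hausdorff.
rewrite (_ : (fun k => _) = fun k =>
   cos_coeff (a - b) k *: (2^-1 *: P) + sin_coeff (a - b) k *: (J * (2^-1 *: P))
 + (cos_coeff (a + b) k *: (2^-1 *: Q)
    + sin_coeff (a + b) k *: (J * (2^-1 *: Q)))); last first.
  apply/funext => k; rewrite AE scalerDr !scalerAl !sqrN1_expr // !mulrDl.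
  by rewrite -!scalerAl !mul1r.
rewrite !series_addf.
have cC (x : R) : series (cos_coeff x) @ \oo --> cos x.
  by rewrite cos.unlock; exact: is_cvg_series_cos_coeff.
have cS (x : R) : series (sin_coeff x) @ \oo --> sin x.
  by rewrite sin.unlock; exact: is_cvg_series_sin_coeff.
by apply: cvgD; apply: cvgD; apply: cvg_series_scale.
Qed.

(** * Identities for [isoc] and [Kmx] *)

Lemma isocE (R : realType) (L : 'cV[R]_3) :
  let x := L o0 0 in let y := L o1 0 in let z := L o2 0 in
  isoc L = mx_of_rows 4 [:: [::   0; - z;   y; - x];
                            [::   z;   0; - x; - y];
                            [:: - y;   x;   0; - z];
                            [::   x;   y;   z;   0]].
Proof.
move=> x y z; apply/matrixP => i j; rewrite /isoc !mxE.
case: (@splitP 3 1 i) => i' -> ; rewrite !mxE; case: (@splitP 3 1 j) => j' ->;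
  rewrite !mxE ?(ord1 i') ?(ord1 j').
- by case: i' j' => -[|[|[|//]]] ? [] [|[|[|//]]] ?.
- by case: i' => -[|[|[|//]]] ?; congr (- L _ _); apply: val_inj.
- by case: j' => -[|[|[|//]]] ?; congr (L _ _); apply: val_inj.
- by [].
Qed.

Lemma isoc_skew (R : realType) (L : 'cV[R]_3) : (isoc L)^T = - isoc L.
Proof.
apply/matrixP => -[[|[|[|[|//]]]] ?] [[|[|[|[|//]]]] ?];
  by rewrite isocE !mxE /= ?oppr0 ?opprK.
Qed.

Lemma Kmx_skew (R : realType) : (Kmx R)^T = - Kmx R.
Proof.
apply/matrixP => -[[|[|[|[|//]]]] ?] [[|[|[|[|//]]]] ?];
  by rewrite !mxE /= ?oppr0 ?opprK.
Qed.

Lemma Kmx_sqr (R : realType) : Kmx R * Kmx R = -1.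
Proof.
apply/matrixP => -[[|[|[|[|//]]]] ?] [[|[|[|[|//]]]] ?];
  by rewrite !mxE !big_ord_recl big_ord0 !mxE /=; ring.
Qed.

(** Reading [(v, w)] in R^3 x R as the quaternion [v - w], [isoc L] is left multiplication by the
    imaginary quaternion [L] and [Kmx] is right multiplication by [i]. *)
Lemma isoc_Kmx (R : realType) (L : 'cV[R]_3) : isoc L * Kmx R = Kmx R * isoc L.
Proof.
apply/matrixP => -[[|[|[|[|//]]]] ?] [[|[|[|[|//]]]] ?];
  by rewrite isocE !mxE !big_ord_recl !big_ord0 !mxE /=; ring.
Qed.

Lemma isoc_sqr (R : realType) (L : 'cV[R]_3) :
  isoc L * isoc L = - (L o0 0 ^+ 2 + L o1 0 ^+ 2 + L o2 0 ^+ 2) *: 1.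
Proof.
apply/matrixP => -[[|[|[|[|//]]]] ?] [[|[|[|[|//]]]] ?];
  by rewrite isocE !mxE !big_ord_recl !big_ord0 !mxE /=; ring.
Qed.

Lemma isocZ (R : realType) (c : R) (L : 'cV[R]_3) : isoc (c *: L) = c *: isoc L.
Proof.
apply/matrixP => -[[|[|[|[|//]]]] ?] [[|[|[|[|//]]]] ?];
  by rewrite !isocE !mxE /=; ring.
Qed.

Lemma isoc_delta_sqr (R : realType) (k : 'I_3) :
  isoc (delta_mx k 0 : 'cV[R]_3) * isoc (delta_mx k 0) = -1.
Proof.
rewrite isoc_sqr -[RHS]scaleN1r !mxE; congr (_ *: _).
by case: k => -[|[|[|//]]] ? /=; ring.
Qed.

Lemma isoc_polar (R : realType) (L : 'cV[R]_3) :
  exists r (u : 'cV[R]_3), L = r *: u /\ isoc u * isoc u = -1.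
Proof.
pose s := L o0 0 ^+ 2 + L o1 0 ^+ 2 + L o2 0 ^+ 2.
have s_ge0 : 0 <= s by rewrite !addr_ge0 ?sqr_ge0.
have [s0|s_neq0] := eqVneq s 0.
  (* Here [L = 0], and any unit vector would serve. *)
  exists 0, (delta_mx o0 0); rewrite isoc_delta_sqr scale0r; split=> //.
  move/eqP: s0.
  rewrite !paddr_eq0 ?addr_ge0 ?sqr_ge0// !sqrf_eq0.
  move=> /andP[/andP[/eqP x0 /eqP y0] /eqP z0]; apply/colP => i; rewrite mxE.
  by case: i => -[|[|[|//]]] p; [rewrite -x0|rewrite -y0|rewrite -z0];
    congr (L _ _); apply: val_inj.
have r2 : Num.sqrt s ^+ 2 = s by rewrite sqr_sqrtr.
have r_neq0 : Num.sqrt s != 0 by rewrite -sqrf_eq0 r2.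
exists (Num.sqrt s), ((Num.sqrt s)^-1 *: L); split.
  by rewrite scalerA divff ?scale1r.
by rewrite isoc_sqr -[RHS]scaleN1r !mxE !exprMn -!mulrDr exprVn r2 -/s mulVf.
Qed.

(** * Elements of [G] and their commutant *)

Lemma G_expmx (R : realType) (u : 'cV[R]_3) (a b : R) : isoc u * isoc u = -1 ->
  expmx (2^-1 *: (isoc (a *: u) + b *: Kmx R)) =
  (cos (a / 2) *: 1 + sin (a / 2) *: isoc u)
  * (cos (b / 2) *: 1 + sin (b / 2) *: Kmx R).
Proof.
move=> u2; rewrite isocZ scalerDr !scalerA ![2^-1 * _]mulrC.
by rewrite expmx_commuting ?isoc_Kmx ?Kmx_sqr.
Qed.

(* [tau = pi] with [L = 0]; likewise [L = pi *: e_k] with [tau = 0] below. *)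
Lemma G_Kmx (R : realType) : G (Kmx R).
Proof.
exists (0 *: delta_mx o0 0), pi; rewrite G_expmx ?isoc_delta_sqr //.
by rewrite mul0r cos0 sin0 cos_pihalf sin_pihalf !scale0r !scale1r addr0 add0r mul1r.
Qed.

Lemma G_isoc_delta (R : realType) (k : 'I_3) : G (isoc (delta_mx k 0 : 'cV[R]_3)).
Proof.
exists (pi *: delta_mx k 0), 0; rewrite G_expmx ?isoc_delta_sqr //.
by rewrite mul0r cos0 sin0 cos_pihalf sin_pihalf !scale0r !scale1r addr0 add0r mulr1.
Qed.

(** As [J] is skew, transposing reverses the angle, and the product is [cos^2 + sin^2]. *)
Lemma rotation_orthogonal (R : realType) n (J : 'M[R]_n.+1) (t : R) :
  J^T = - J -> J * J = -1 ->
  (cos t *: 1 + sin t *: J)^T * (cos t *: 1 + sin t *: J) = 1.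
Proof.
move=> JT J2; rewrite linearD !linearZ /= trmx1 JT.
rewrite mulrDl !mulrDr -!scalerAl -!scalerAr !mul1r mulr1 mulNr J2 opprK.
rewrite -[RHS]scale1r -(cos2Dsin2 t).
move: (1 : 'M[R]_n.+1) => I_.
by apply/matrixP => i j; rewrite !mxE; ring.
Qed.

Lemma G_orthogonal (R : realType) (S : 'M[R]_4) : G S -> S^T *m S = 1.
Proof.
move=> [L [tau ->]]; have [r [u [-> u2]]] := isoc_polar _ L.
rewrite G_expmx // trmx_mul mulmxE mulrA -(mulrA (_^T)).
rewrite [X in _ * X * _]rotation_orthogonal ?isoc_skew // mulr1.
by rewrite rotation_orthogonal ?Kmx_skew ?Kmx_sqr.
Qed.

Lemma G_comm_Kmx (R : realType) (S : 'M[R]_4) : G S -> S *m Kmx R = Kmx R *m S.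
Proof.
move=> [L [tau ->]]; have [r [u [-> u2]]] := isoc_polar _ L.
rewrite G_expmx // mulmxE; apply/esym.
have K1 : GRing.comm (Kmx R) (Kmx R) by [].
have KJ : GRing.comm (Kmx R) (isoc u) by rewrite /GRing.comm isoc_Kmx.
have KZ c (A : 'M[R]_4) : GRing.comm (Kmx R) A -> GRing.comm (Kmx R) (c *: A).
  by rewrite /GRing.comm -scalerAr -scalerAl => ->.
by apply: commrM; apply: commrD; apply: KZ => //; exact: commr1.
Qed.

(** In quaternion terms, commuting with all left multiplications makes [B] a right multiplication,
    and commuting with [Kmx] puts its multiplier in the span of 1 and [i]. *)
Lemma commutant_isoc_Kmx (R : realType) (B : 'M[R]_4) :
  (forall k : 'I_3, B *m isoc (delta_mx k 0) = isoc (delta_mx k 0) *m B) ->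
  B *m Kmx R = Kmx R *m B -> exists a b, B = a%:M + b *: Kmx R.
Proof.
(* The last column of [a%:M + b *: Kmx R] is [(-b, 0, 0, a)]. *)
move=> BJ BK; exists (B ord_max ord_max), (- B ord0 ord_max).
(* Indexing by [nat] identifies entries whose ordinals differ only in their proofs, so that [lra]
   sees equal atoms. *)
have [b Bb] : exists b : nat -> nat -> R, forall i j, B i j = b i j.
  by exists (fun i j => B (inord i) (inord j)) => i j; rewrite !inord_val.
(* The last columns of the four commutation relations suffice: [isoc e_k] sends
   [e_4] to [- e_k], so they express every column of [B] through its last one. *)
have colE (J : 'M[R]_4) (i : 'I_4) : B *m J = J *m B ->
    b i 0%N * J ord0 ord_max + (b i 1%N * J (lift ord0 ord0) ord_max
    + (b i 2%N * J (lift ord0 (lift ord0 ord0)) ord_max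
    + b i 3%N * J ord_max ord_max)) =
    J i ord0 * b 0%N 3%N + (J i (lift ord0 ord0) * b 1%N 3%N
    + (J i (lift ord0 (lift ord0 ord0)) * b 2%N 3%N + J i ord_max * b 3%N 3%N)).
  move=> /matrixP/(_ i ord_max); rewrite !mxE !big_ord_recl !big_ord0 !Bb !addr0.
  by rewrite (_ : lift ord0 (lift ord0 (lift ord0 ord0)) = ord_max) //; apply: val_inj.
have E1 i := colE _ i (BJ o0).
have E2 i := colE _ i (BJ o1).
have E3 i := colE _ i (BJ o2).
have E4 i := colE _ i BK.
have ev (P : 'I_4 -> Prop) : (forall i, P i) ->
    [/\ P (@Ordinal 4 0 isT), P (@Ordinal 4 1 isT), P (@Ordinal 4 2 isT) &
        P (@Ordinal 4 3 isT)] by move=> H; split; apply: H.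
pose simp := (oppr0, mulrN1, mulN1r, mulr0, mul0r, mulr1, mul1r, addr0, add0r).
move: (ev _ E1); rewrite !isocE !mxE /= !simp => -[? ? ? ?].
move: (ev _ E2); rewrite !isocE !mxE /= !simp => -[? ? ? ?].
move: (ev _ E3); rewrite !isocE !mxE /= !simp => -[? ? ? ?].
move: (ev _ E4); rewrite !mxE /= !simp => -[? ? ? ?].
apply/matrixP => -[[|[|[|[|//]]]] ?] [[|[|[|[|//]]]] ?];
  by rewrite !mxE !Bb /=; lra.
Qed.

(** * Kronecker products acting on phase space *)

Lemma sum_mxtens_index (V : nmodType) m n (F : 'I_(m * n) -> V) :
  \sum_k F k = \sum_(i < m) \sum_(a < n) F (mxtens_index (i, a)).
Proof.
rewrite pair_bigA /= (reindex (@mxtens_index m n)).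
  by apply: eq_bigr => -[].
by exists (@mxtens_unindex m n) => k _; rewrite (mxtens_indexK, mxtens_unindexK).
Qed.

Lemma tens1mx_mulE (R : comPzRingType) m n (S : 'M[R]_n) (X : 'cV[R]_(m * n)) i a :
  (((1%:M : 'M[R]_m) *t S) *m X) (mxtens_index (i, a)) 0 =
  \sum_b S a b * X (mxtens_index (i, b)) 0.
Proof.
rewrite mxE sum_mxtens_index (bigD1 i) //= [X in _ + X]big1 ?addr0.
  by apply: eq_bigr => b _; rewrite tensmxE mxE eqxx mul1r.
move=> j ji; apply: big1 => b _.
by rewrite tensmxE mxE eq_sym (negbTE ji) !mul0r.
Qed.

Lemma tensmx1_mulE (R : comPzRingType) m n (A : 'M[R]_m) (X : 'cV[R]_(m * n)) i a :
  ((A *t (1%:M : 'M[R]_n)) *m X) (mxtens_index (i, a)) 0 =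
  \sum_j A i j * X (mxtens_index (j, a)) 0.
Proof.
rewrite mxE sum_mxtens_index; apply: eq_bigr => j _.
rewrite (bigD1 a) //= [X in _ + X]big1 ?addr0 => [|b ba].
  by rewrite tensmxE mxE eqxx mulr1.
by rewrite tensmxE mxE eq_sym (negbTE ba) mulr0 mul0r.
Qed.

Lemma PsiE (R : realType) (S : 'M[R]_4) (X : phase R) : Psi S X = ((1%:M : 'M[R]_6) *t S) *m X.
Proof.
apply/colP => k; case: (mxtens_indexP k) => p a.
rewrite tens1mx_mulE mxE mxtens_indexK /=.
by case: (@splitP 3 3 p) => i pE; rewrite mxE; apply: eq_bigr => b _;
  rewrite mxE; congr (_ * X (mxtens_index (_, b)) 0); apply: val_inj.
Qed.

(** * Quadratic forms and their matrices *)

Lemma qform_linear (R : realType) (c : R) (M N : 'M[R]_(6 * 4)) (X : phase R) :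
  qform (c *: M + N) X = c * qform M X + qform N X.
Proof. by rewrite /qform mulmxDr mulmxDl -scalemxAr -scalemxAl !mxE. Qed.

Lemma qform_trmx (R : realType) (M : 'M[R]_(6 * 4)) (X : phase R) :
  qform M^T X = qform M X.
Proof.
rewrite /qform (_ : X^T *m M^T *m X = (X^T *m M *m X)^T); first by rewrite mxE.
by rewrite !trmx_mul trmxK mulmxA.
Qed.

Lemma qform_sympart (R : realType) (M : 'M[R]_(6 * 4)) : qform (sympart M) = qform M.
Proof.
apply/funext => X; rewrite /sympart scalerDr qform_linear.
rewrite -[2^-1 *: M^T]addr0 qform_linear qform_trmx.
by rewrite /qform mulmx0 mul0mx [in X in _ + (_ + X)]mxE; field.
Qed.

Lemma qformD (R : realType) (M : 'M[R]_(6 * 4)) (X Y : phase R) :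
  qform M (X + Y) =
  qform M X + (X^T *m M *m Y) 0 0 + (Y^T *m M *m X) 0 0 + qform M Y.
Proof.
rewrite /qform [(X + Y)^T]linearD /= 2!mulmxDl 2!mulmxDr.
by rewrite !mxE; ring.
Qed.

Lemma delta_mx_mulE (R : comPzRingType) m (X : 'cV[R]_m) k :
  ((delta_mx k 0 : 'cV[R]_m)^T *m X) 0 0 = X k 0.
Proof. by rewrite trmx_delta -rowE mxE. Qed.

(** Polarisation at two basis vectors recovers twice an entry of a symmetric matrix. *)
Lemma qform_sym_inj (R : realType) (M N : 'M[R]_(6 * 4)) :
  M^T = M -> N^T = N -> qform M =1 qform N -> M = N.
Proof.
move=> MT NT MN; apply/matrixP => i j.
have polar (A : 'M[R]_(6 * 4)) : A^T = A ->
    qform A (delta_mx i 0 + delta_mx j 0)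
      - qform A (delta_mx i 0) - qform A (delta_mx j 0) = 2 * A i j.
  have dE k l : ((delta_mx k 0 : phase R)^T *m A *m (delta_mx l 0 : phase R)) 0 0 = A k l.
    by rewrite -mulmxA delta_mx_mulE -colE mxE.
  move=> AT; rewrite qformD !dE -[in A j i]AT mxE; ring.
have /(congr1 ( *%R 2^-1)) : 2 * M i j = 2 * N i j by rewrite -!polar // !MN.
by rewrite !mulKf.
Qed.

(** * The algebra of matrices [a *t 1 + b *t K] *)

(** As [Kmx] is skew, symmetrising keeps the symmetric part of [a] and the skew part of [b], and a
    single [W] encodes both. *)
Lemma sympart_tens_Kmx (R : realType) (a b : 'M[R]_6) :
  sympart (a *t (1%:M : 'M[R]_4) + b *t Kmx R) = inv_mx (sympart a + skewpart b).
Proof.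
rewrite /inv_mx /sympart /skewpart [(_ *t _ + _)^T]linearD /= !trmx_tens trmx1 Kmx_skew.
move: (Kmx R) (1%:M : 'M[R]_4) => K I_.
by apply/matrixP => i j; rewrite !mxE; field.
Qed.

Lemma inv_mx_sym (R : realType) (W : 'M[R]_6) : (inv_mx W)^T = inv_mx W.
Proof.
rewrite /inv_mx /sympart /skewpart [(_ *t _ + _)^T]linearD /= !trmx_tens trmx1 Kmx_skew.
move: (Kmx R) (1%:M : 'M[R]_4) => K I_.
by apply/matrixP => i j; rewrite !mxE; ring.
Qed.

Lemma quad_inv_tens_Kmx (R : realType) (a b : 'M[R]_6) :
  quad_inv (qform (a *t (1%:M : 'M[R]_4) + b *t Kmx R)).
Proof. by exists (sympart a + skewpart b); rewrite -sympart_tens_Kmx qform_sympart. Qed.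

(** With [K] squaring to [-1], this is the product of the complex matrices [a + i b] and
    [c + i d]. *)
Lemma tens_Kmx_mul (R : realType) (a b c d : 'M[R]_6) :
  (a *t (1%:M : 'M[R]_4) + b *t Kmx R) *m (c *t (1%:M : 'M[R]_4) + d *t Kmx R) =
  (a *m c - b *m d) *t (1%:M : 'M[R]_4) + (a *m d + b *m c) *t Kmx R.
Proof.
rewrite mulmxDl !mulmxDr !tensmx_mul !mulmx1 !mul1mx.
rewrite (_ : Kmx R *m Kmx R = - 1%:M); last exact: Kmx_sqr.
move: (a *m c) (a *m d) (b *m c) (b *m d) (Kmx R) (1%:M : 'M[R]_4) => ? ? ? ? ? ?.
by apply/matrixP => i j; rewrite !mxE; ring.
Qed.

(** * Poisson brackets of quadratic forms *)

(** For nonzero [h] the difference quotient is affine in [h], with the claimed value as constant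
    term. *)
Lemma partial_qform (R : realType) (M : 'M[R]_(6 * 4)) k (X : phase R) :
  partial (qform M) k X = ((M + M^T) *m X) k 0.
Proof.
set d : phase R := delta_mx k 0.
have dE h : qform M (h *: d + X) =
    h * (h * qform M d) + h * ((M + M^T) *m X) k 0 + qform M X.
  have dMX : (d^T *m M *m X) 0 0 = (M *m X) k 0.
    by rewrite -mulmxA delta_mx_mulE.
  have XMd : (X^T *m M *m d) 0 0 = (M^T *m X) k 0.
    by rewrite -(trmxK (X^T *m M *m d)) mxE !trmx_mul trmxK delta_mx_mulE.
  rewrite qformD /qform [(h *: d)^T]linearZ /= -!(scalemxAl, scalemxAr).
  rewrite mulmxDl ![((_ : R) *: (_ : 'M[_]_1)) 0 0]mxE dMX XMd.
  by rewrite [(M *m X + _) k 0]mxE; ring.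
rewrite /partial /derive; apply: cvg_lim => //.
apply: (@cvg_trans _ ((fun h : R => h * qform M d + ((M + M^T) *m X) k 0) @ 0^')).
  apply: near_eq_cvg; near=> h.
  have h0 : h != 0 by near: h; exact: nbhs_dnbhs_neq.
  by rewrite /= dE addrK /GRing.scale /= -mulrDr mulKf.
have /cvg_within_filter : (h * qform M d + ((M + M^T) *m X) k 0) @[h --> (0 : R)]
    --> 0 * qform M d + ((M + M^T) *m X) k 0.
  by apply: cvgD; [apply: cvgMr_tmp; exact: cvg_id|exact: cvg_cst].
by rewrite mul0r add0r; exact.
Unshelve. all: by end_near.
Qed.

Definition symplectic_mx (R : realType) : 'M[R]_6 :=
  @block_mx R 3 3 3 3 0 1%:M (- 1%:M) 0.

Lemma symplectic_mx_mulE (R : realType) (X : phase R) i a :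
  let Y := (symplectic_mx R *t (1%:M : 'M[R]_4)) *m X in
  Y (Qidx i a) 0 = X (Pidx i a) 0 /\ Y (Pidx i a) 0 = - X (Qidx i a) 0.
Proof.
rewrite /= /Qidx /Pidx /symplectic_mx !tensmx1_mulE !(@big_split_ord _ _ _ 3 3) /=; split.
  rewrite big1 => [|j _]; last by rewrite (@block_mxEul _ 3 3 3 3) mxE mul0r.
  rewrite add0r (bigD1 i) //= big1 => [|j ji].
    by rewrite (@block_mxEur _ 3 3 3 3) mxE eqxx mul1r addr0.
  by rewrite (@block_mxEur _ 3 3 3 3) mxE eq_sym (negbTE ji) mul0r.
rewrite [X in _ + X]big1 => [|j _]; last by rewrite (@block_mxEdr _ 3 3 3 3) mxE mul0r.
rewrite addr0 (bigD1 i) //= big1 => [|j ji].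
  by rewrite (@block_mxEdl _ 3 3 3 3) !mxE eqxx mulN1r addr0.
by rewrite (@block_mxEdl _ 3 3 3 3) !mxE eq_sym (negbTE ji) oppr0 mul0r.
Qed.

(** The gradients at [X] are [u] and [v] below, and the bracket pairs them through the symplectic
    matrix. *)
Lemma poisson_qform (R : realType) (M N : 'M[R]_(6 * 4)) :
  poisson (qform M) (qform N) =
  qform ((M + M^T) *m (symplectic_mx R *t (1%:M : 'M[R]_4)) *m (N + N^T)).
Proof.
apply/funext => X; rewrite /poisson /qform.
set u := (M + M^T) *m X; set v := (N + N^T) *m X.
have -> : X^T *m ((M + M^T) *m (symplectic_mx R *t (1%:M : 'M[R]_4)) *m (N + N^T)) *m X
        = u^T *m ((symplectic_mx R *t (1%:M : 'M[R]_4)) *m v).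
  by rewrite /u /v trmx_mul [(M + M^T)^T]linearD /= trmxK [M^T + M]addrC !mulmxA.
rewrite mxE sum_mxtens_index (@big_split_ord _ _ _ 3 3) /= -big_split /=.
apply: eq_bigr => i _; rewrite -big_split /=; apply: eq_bigr => a _.
have [vQ vP] := symplectic_mx_mulE _ v i a.
by rewrite !partial_qform -/u -/v ![u^T _ _]mxE vQ vP mulrN.
Qed.

Lemma quad_inv_poisson (R : realType) (f g : phase R -> R) :
  quad_inv f -> quad_inv g -> quad_inv (poisson f g).
Proof.
move=> [W ->] [W' ->]; rewrite poisson_qform !inv_mx_sym.
have dbl (A : 'M[R]_6) : inv_mx A + inv_mx A =
    (A + A^T) *t (1%:M : 'M[R]_4) + (A - A^T) *t Kmx R.
  rewrite /inv_mx /sympart /skewpart.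
  move: (Kmx R) (1%:M : 'M[R]_4) => K I_.
  by apply/matrixP => i j; rewrite !mxE; field.
(* With a zero [K] component added, all three factors lie in the algebra. *)
have -> : symplectic_mx R *t (1%:M : 'M[R]_4) =
    symplectic_mx R *t (1%:M : 'M[R]_4) + 0 *t Kmx R by rewrite tens0mx addr0.
rewrite !dbl !tens_Kmx_mul; exact: quad_inv_tens_Kmx.
Qed.

Lemma quad_inv_linear (R : realType) (c : R) (f g : phase R -> R) :
  quad_inv f -> quad_inv g -> quad_inv (fun X => c * f X + g X).
Proof.
move=> [W ->] [W' ->]; exists (c *: W + W'); apply/funext => X.
rewrite -qform_linear; congr (qform _ X).
rewrite /inv_mx /sympart /skewpart.
move: (Kmx R) (1%:M : 'M[R]_4) => K I_.
by apply/matrixP => i j; rewrite !mxE; field.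
Qed.

(** * Invariance as blockwise commutation *)

Lemma tens_block_ext (R : realType) m n (M N : 'M[R]_(m * n)) :
  (forall i j a b, M (mxtens_index (i, a)) (mxtens_index (j, b)) =
                   N (mxtens_index (i, a)) (mxtens_index (j, b))) -> M = N.
Proof.
move=> MN; apply/matrixP => k l.
by case: (mxtens_indexP k) => i a; case: (mxtens_indexP l) => j b.
Qed.

Definition tens_block {R : realType} {m n} (M : 'M[R]_(m * n)) i j : 'M[R]_n :=
  \matrix_(a, b) M (mxtens_index (i, a)) (mxtens_index (j, b)).

(** [1 *t S] is block diagonal, so it multiplies each block of [M] by [S]. *)
Lemma tens_block_comm (R : realType) m n (M : 'M[R]_(m * n)) (S : 'M[R]_n) i j :
  M *m ((1%:M : 'M[R]_m) *t S) = ((1%:M : 'M[R]_m) *t S) *m M ->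
  tens_block M i j *m S = S *m tens_block M i j.
Proof.
move=> MS; apply/matrixP => a b.
move/matrixP/(_ (mxtens_index (i, a)) (mxtens_index (j, b))): MS.
rewrite !mxE !sum_mxtens_index (bigD1 j) //= [X in _ + X = _]big1 ?addr0 => [|k kj]; last first.
  by apply: big1 => c _; rewrite tensmxE mxE (negbTE kj) mul0r mulr0.
rewrite (bigD1 i) //= [X in _ = _ + X]big1 ?addr0 => [|k ki]; last first.
  by apply: big1 => c _; rewrite tensmxE mxE eq_sym (negbTE ki) !mul0r.
move=> E; apply: etrans (etrans E _); apply: eq_bigr => c _;
  by rewrite tensmxE !mxE eqxx mul1r.
Qed.

Lemma qform_Psi (R : realType) (M : 'M[R]_(6 * 4)) (S : 'M[R]_4) (X : phase R) :
  qform M (Psi S X) =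
  qform (((1%:M : 'M[R]_6) *t S)^T *m M *m ((1%:M : 'M[R]_6) *t S)) X.
Proof. by rewrite PsiE /qform trmx_mul !mulmxA. Qed.

Lemma tens1mx_orthogonal (R : realType) m n (S : 'M[R]_n) : S^T *m S = 1%:M ->
  ((1%:M : 'M[R]_m) *t S)^T *m ((1%:M : 'M[R]_m) *t S) = 1%:M.
Proof.
move=> SS; rewrite trmx_tens tensmx_mul trmx1 mulmx1 SS.
apply/matrixP => k l; case: (mxtens_indexP k) => i a; case: (mxtens_indexP l) => j b.
by rewrite tensmxE !mxE (can_eq (@mxtens_indexK m n)) xpair_eqE -natrM mulnb.
Qed.

(** Invariance equates the symmetric matrices [T^T M T] and [M]; orthogonality of [T] turns this
    into commutation. *)
Lemma qform_invariantP (R : realType) (M : 'M[R]_(6 * 4)) (S : 'M[R]_4) :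
  M^T = M -> S^T *m S = 1%:M ->
  (forall X, qform M (Psi S X) = qform M X) <->
  M *m ((1%:M : 'M[R]_6) *t S) = ((1%:M : 'M[R]_6) *t S) *m M.
Proof.
move=> MT /(tens1mx_orthogonal _ 6); set T := _ *t S => TT; split=> [inv|MS X].
  have E : T^T *m M *m T = M.
    apply: qform_sym_inj => // [|X]; last by rewrite -qform_Psi.
    by rewrite !trmx_mul trmxK MT mulmxA.
  by rewrite -[in RHS]E !mulmxA (mulmx1C TT) mul1mx.
by rewrite qform_Psi -/T -mulmxA MS mulmxA TT mul1mx.
Qed.

Lemma inv_mx_comm (R : realType) (W : 'M[R]_6) (S : 'M[R]_4) :
  S *m Kmx R = Kmx R *m S ->
  inv_mx W *m ((1%:M : 'M[R]_6) *t S) = ((1%:M : 'M[R]_6) *t S) *m inv_mx W.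
Proof.
by move=> SK; rewrite /inv_mx mulmxDl mulmxDr !tensmx_mul !mulmx1 !mul1mx SK.
Qed.

Lemma invariant_inv_mx (R : realType) (M : 'M[R]_(6 * 4)) : M^T = M ->
  (forall S : 'M[R]_4, G S -> forall X : phase R, qform M (Psi S X) = qform M X) ->
  exists W : 'M[R]_6, M = inv_mx W.
Proof.
move=> MT inv.
have comm S : G S -> forall i j, tens_block M i j *m S = S *m tens_block M i j.
  move=> GS i j; apply: tens_block_comm; apply/qform_invariantP => //.
    exact: G_orthogonal.
  exact: inv.
have [a [b Mab]] : exists a b : 'I_6 -> 'I_6 -> R,
    forall i j, tens_block M i j = (a i j)%:M + b i j *: Kmx R.
  have blk i j : exists p : R * R, tens_block M i j = p.1%:M + p.2 *: Kmx R.
    have [|x [y ->]] := commutant_isoc_Kmx _ _ _ (comm _ (G_Kmx R) i j).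
      by move=> k; apply: comm; exact: G_isoc_delta.
    by exists (x, y).
  (* Classical choice turns the blockwise coefficients into functions of the block. *)
  exists (fun i j => (sval (cid (blk i j))).1), (fun i j => (sval (cid (blk i j))).2).
  by move=> i j; case: cid.
pose A := \matrix_(i, j) a i j; pose B := \matrix_(i, j) b i j.
have ME : M = A *t (1%:M : 'M[R]_4) + B *t Kmx R.
  apply: tens_block_ext => i j c d.
  have /matrixP/(_ c d) := Mab i j; rewrite mxE => ->.
  by rewrite mxE [in RHS]mxE !tensmxE !mxE mulr_natr.
(* Being symmetric, [M] equals its own symmetric part. *)
exists (sympart A + skewpart B); rewrite -sympart_tens_Kmx -ME /sympart MT.
by apply/matrixP => i j; rewrite !mxE; field.
Qed.

Theorem lemma4p1 (R : realType) :
  (forall M : 'M[R]_(6 * 4),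
     (M^T = M /\
      forall S : 'M[R]_4, G S ->
        forall X : phase R, qform M (Psi S X) = qform M X) <->
     exists W : 'M[R]_6, M = sympart W *t (1%:M : 'M[R]_4) + skewpart W *t Kmx R) /\
  [/\ quad_inv (cst 0 : phase R -> R),
      forall (c : R) (f g : phase R -> R), quad_inv f -> quad_inv g ->
        quad_inv (fun X => c * f X + g X) &
      forall f g : phase R -> R, quad_inv f -> quad_inv g ->
        quad_inv (poisson f g)].
Proof.
split; last split; last exact: quad_inv_poisson.
- move=> M; split=> [[]|[W ->]]; first exact: invariant_inv_mx.
  split=> [|S GS]; first exact: inv_mx_sym.
  apply/qform_invariantP; [exact: inv_mx_sym|exact: G_orthogonal|].
  by apply: inv_mx_comm; exact: G_comm_Kmx.
- have -> : (cst 0 : phase R -> R) = qform (0 *t (1%:M : 'M[R]_4) + 0 *t Kmx R).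
    by apply/funext => X; rewrite !tens0mx addr0 /qform mulmx0 mul0mx mxE.
  exact: quad_inv_tens_Kmx.
- exact: quad_inv_linear.
Qed.
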